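(* There exist positive constants $C,C_1,C_2,C_3,C_4,C_5$ that do not depend on $\alpha$, $\lambda$, and $X$ such that the following holds. Let $\alpha>1$, let $\beta$ be its conjugate, $\frac1\alpha+\frac1\beta=1$, and let $X$ be a mean-zero real random variable with $\|X\|_{\Psi_\alpha}<\infty$. Then for any $\lambda\ge0$: (1) if $\alpha\ge2$, then $$\mathbb E\{\exp(\lambda X)\}\le\exp\left(C_1\min\left\{\lambda^2\|X\|_{\Psi_\alpha}^2,\lambda^\beta\|X\|_{\Psi_\alpha}^\beta\right\}\right);$$ (2) if $\alpha\in(1,2]$, then $$\mathbb E\{\exp(\lambda X)\}\le\exp\left(C_2\beta\lambda^2\|X\|_{\Psi_\alpha}^2\right)\quad\text{when }\lambda\le 1/(C\|X\|_{\Psi_\alpha}),$$ $$\mathbb E\{\exp(\lambda X)\}\le\exp\left(C_3^\beta\beta\lambda^\beta\|X\|_{\Psi_\alpha}^\beta\right)\quad\text{when }\lambda\ge 1/(C\|X\|_{\Psi_\alpha});$$ and further, for any $\tau\in(0,1)$, $$\mathbb E\{\exp(\lambda X)\}\le\exp\left(C_4\frac{1}{1-\tau}\lambda^2\|X\|_{\Psi_\alpha}^2\right)\quad\text{when }\lambda\le\tau/(C\|X\|_{\Psi_\alpha}),$$ $$\mathbb E\{\exp(\lambda X)\}\le\exp\left(C_5^\beta\frac{\tau^{-[\beta]-1}}{1-\tau}\lambda^\beta\|X\|_{\Psi_\alpha}^\beta\right)\quad\text{when }\lambda\ge\tau/(C\|X\|_{\Psi_\alpha}).$$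
   Context: For a real random variable $X$ and $\alpha\ge1$, the Orlicz norm is $\|X\|_{\Psi_\alpha}:=\inf\{u>0:\ \mathbb E\exp((|X|/u)^\alpha)\le 2\}$. $[a]$ denotes the largest integer not exceeding $a$. *)

(* Defs.v *)
From HB Require Import structures.
From mathcomp Require Import all_boot all_order all_algebra.
From mathcomp Require Import all_classical all_reals all_analysis.

Set Implicit Arguments.
Unset Strict Implicit.
Unset Printing Implicit Defensive.

Import Order.TTheory GRing.Theory Num.Theory.
Local Open Scope classical_set_scope.
Local Open Scope ring_scope.

(* The infimum is taken in [\bar R], so the norm is [+oo] exactly when no
   [u > 0] is admissible. *)
Definition orlicz_norm (d : measure_display) (T : measurableType d)
    (R : realType) (P : probability T R) (alpha : R) (X : T -> R) : \bar R :=
  ereal_inf [set u%:E | u in [set u : R | 0 < u /\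
    ('E_P[fun w => expR ((`|X w| / u) `^ alpha)] <= 2%:E)%E]].

(* Main.v *)
Require Import Defs.
From HB Require Import structures.
From mathcomp Require Import all_boot all_order all_algebra.
From mathcomp Require Import all_classical all_reals all_analysis.
From mathcomp Require Import measurable_realfun.
From mathcomp Require Import ring lra.

Set Implicit Arguments.
Unset Strict Implicit.
Unset Printing Implicit Defensive.

Import Order.TTheory GRing.Theory Num.Theory.
Local Open Scope ring_scope.

(** Write [N] for the Orlicz norm and [K = lambda N]. With the threshold
    [K = 1/4], i.e. [C = 4], all five bounds follow from two estimates.

    For [K <= 1/4], [X] is treated as a sub-exponential variable. A Taylor
    inequality [e^s <= 1 + s + s^2 e^|s|], together with the domination
    [e^t <= e * e^(t^alpha)], bounds [e^(lambda X)] by [1 + lambda X] plus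
    a constant times [(lambda u)^2 e^((|X|/u)^alpha)], whose last factor has mean
    at most [2] when [u] is admissible in the norm; the linear term disappears in expectation because [X] is centred
    ([mgf_le_sub_gaussian]). This gives [exp(G K^2)] with an absolute constant
    [G], so the factors [beta >= 1] and [1/(1-tau) >= 1] are slack.

    For [K >= tau/4], Young's inequality
    [lambda X <= (|X|/u)^alpha + (lambda u)^beta] gives
    [E e^(lambda X) <= 2 exp((lambda u)^beta)] for every [u] admissible in the
    norm, and the prefactor [2] is absorbed since [(4 K / tau)^beta >= 1]; the
    result is [exp((8 K / tau)^beta)] ([mgf_le_young_norm]). For [alpha >= 2]
    one has [beta <= 2], so beyond the threshold [(8 K)^beta] is at most both
    [64 K^beta] and [64 K^2], while below it [K^2 <= K^beta]; hence the
    minimum.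

    Whether [N] itself is admissible is never an issue: if [N > 0] some
    admissible [u] lies below [2 N], and the factor [2] goes into the constants;
    if [N = 0], there are arbitrarily small admissible [u], and the first
    estimate forces [E e^(lambda X) <= 1]. *)

(** * Scalar inequalities *)

Section scalar_inequalities.
Variable R : realType.
Implicit Types s x y a b t u l tau K : R.

(** Both [e^s (1 - s) <= 1] and [1 + s <= e^s] are instances of the tangent
    inequality; the first gives [e^s - 1 - s <= s (e^s - 1)], and the second
    controls the right-hand side for either sign of [s]. *)
Lemma expR_le_taylor1 s : expR s <= 1 + s + s ^+ 2 * expR `|s|.
Proof.
have h : expR s - 1 <= s * expR s.
  have := expR_ge1Dx (- s); have := expRxMexpNx_1 s; have := expR_gt0 s; nra.
have hs := expR_ge1Dx s.
have [s0|s0] := leP 0 s.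
  rewrite ger0_norm //; nra.
rewrite ltr0_norm //.
have : 1 <= expR (- s) by rewrite -expR0 ler_expR; lra.
nra.
Qed.

Lemma sqr_le_expR_half y : 0 <= y -> y ^+ 2 <= 16 * expR (y / 2).
Proof.
move=> y0; have -> : y / 2 = y / 4 + y / 4 by field.
by rewrite expRD; have := expR_ge1Dx (y / 4); nra.
Qed.

Lemma expR_le_powR t a : 0 <= t -> 1 <= a -> expR t <= expR 1 * expR (t `^ a).
Proof.
move=> t0 a1; rewrite -expRD ler_expR.
have [t1|t1] := leP t 1; first by have := powR_ge0 t a; lra.
suff : t <= t `^ a by lra.
by rewrite -[leLHS]powRr1 // ler_powR // ltW.
Qed.

(** Pointwise form of the estimate for small [l u]. With [y = |x|/u], the
    quadratic remainder is [(l u)^2 y^2 e^(l u y)]; since [l u <= 1/2], half of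
    the exponent [y] pays for [e^(l u y)] and the other half for [y^2]. *)
Lemma expR_le_orlicz_quad a u l x : 1 <= a -> 0 < u -> 0 <= l -> l * u <= 1 / 2 ->
  expR (l * x) <=
  1 + l * x + 16 * expR 1 * (l * u) ^+ 2 * expR ((`|x| / u) `^ a).
Proof.
move=> a1 u0 l0 lu; apply: le_trans (expR_le_taylor1 _) _; rewrite lerD2l.
have y0 : 0 <= `|x| / u by rewrite divr_ge0 // ltW.
set y := `|x| / u in y0 *.
have xE : `|x| = y * u by rewrite /y divfK // gt_eqF.
have -> : (l * x) ^+ 2 = (l * u) ^+ 2 * y ^+ 2.
  by rewrite -(real_normK (num_real (l * x))) normrM (ger0_norm l0) xE; ring.
have -> : `|l * x| = (l * u) * y by rewrite normrM (ger0_norm l0) xE; ring.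
rewrite -[leLHS]mulrA [leRHS](_ : _ =
  (l * u) ^+ 2 * (16 * (expR 1 * expR (y `^ a)))); last by ring.
rewrite ler_wpM2l ?sqr_ge0 //.
apply: le_trans (_ : 16 * expR y <= _); last by rewrite ler_pM2l ?expR_le_powR.
have -> : expR y = expR (y / 2) * expR (y / 2) by rewrite -expRD -splitr.
have h1 : expR (l * u * y) <= expR (y / 2) by rewrite ler_expR; nra.
have h2 := sqr_le_expR_half y0.
have := expR_gt0 (y / 2); have := expR_gt0 (l * u * y); nra.
Qed.

(** Pointwise form of the estimate for large [l u]: Young's inequality for the
    product [(|x|/u) (l u)], with its factors [1/a, 1/b <= 1] dropped. *)
Lemma expR_le_orlicz_young a b u l x :
  1 < a -> 1 < b -> a^-1 + b^-1 = 1 -> 0 < u -> 0 <= l ->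
  expR (l * x) <= expR ((l * u) `^ b) * expR ((`|x| / u) `^ a).
Proof.
move=> a1 b1 ab u0 l0; rewrite -expRD ler_expR.
have y0 : 0 <= `|x| / u by rewrite divr_ge0 // ltW.
have k0 : 0 <= l * u by rewrite mulr_ge0 // ltW.
have a0 : 0 < a by lra.
have b0 : 0 < b by lra.
apply: le_trans (_ : `|x| / u * (l * u) <= _).
  rewrite [leRHS](_ : _ = l * `|x|); last by field; rewrite gt_eqF.
  by rewrite ler_wpM2l // ler_norm.
apply: le_trans (conjugate_powR y0 k0 a0 b0 ab) _; rewrite addrC.
by apply: lerD; rewrite ler_pdivrMr // ler_peMr ?powR_ge0 // ltW.
Qed.

(** Absorbs the prefactor [2]: with [L = 4 K / tau >= 1], both [1] and
    [(2 K)^b] are at most [L^b], and [2 <= e], so the exponent is at most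
    [2 L^b <= (2 L)^b]. *)
Lemma two_expR_powR_le b K tau : 1 <= b -> 0 < tau -> tau <= 1 -> tau <= 4 * K ->
  2 * expR ((2 * K) `^ b) <= expR ((8 * K / tau) `^ b).
Proof.
move=> b1 t0 t1 tK.
have L1 : 1 <= 4 * K / tau by rewrite ler_pdivlMr // mul1r.
set L := 4 * K / tau in L1.
have -> : 8 * K / tau = 2 * L by rewrite /L; ring.
have h2 : 2 <= expR (1 : R) by have := expR_ge1Dx (1 : R); lra.
apply: le_trans (ler_wpM2r (expR_ge0 _) h2) _; rewrite -expRD ler_expR.
have hL : 1 <= L `^ b by rewrite -(powRr0 L) ler_powR //; lra.
have h1 : (2 * K) `^ b <= L `^ b.
  apply: ge0_ler_powR; rewrite ?nnegrE; try lra.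
  by rewrite /L ler_pdivlMr //; nra.
rewrite [leRHS]powRM; [|lra..].
have h3 : 2 <= 2 `^ b by rewrite -[leLHS]powRr1 // ler_powR //; lra.
have h4 := ler_wpM2r (powR_ge0 L b) h3; lra.
Qed.

(** The exponent [- floor b - 1] lies below [- b], and [tau < 1], so passing to
    the integer power only increases [tau^(-b)]. *)
Lemma powR_div_floor_le b tau x :
  0 < tau -> tau < 1 -> 0 <= x ->
  (x / tau) `^ b <= x `^ b * (tau ^ (- Num.floor b - 1) / (1 - tau)).
Proof.
move=> t0 t1 x0; rewrite powRM ?invr_ge0 // ?(ltW t0) // ler_wpM2l ?powR_ge0 //.
have t0' := ltW t0.
have -> : tau^-1 `^ b = tau `^ (- b).
  by rewrite -powR_inv1 // -powRrM mulN1r.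
rewrite -powR_intmul // ler_pdivlMr ?subr_gt0 //.
apply: (@le_trans _ _ (tau `^ (- b))).
  by rewrite ler_piMr ?powR_ge0 //; lra.
apply: ger_powR; first by rewrite t0 ltW.
rewrite -opprD mulrNz lerN2.
by rewrite ltW // floorD1_gt.
Qed.

End scalar_inequalities.

(** * Bounds in terms of an admissible scale *)

Section moment_generating_function.
Context (R : realType) (d : measure_display) (T : measurableType d).
Variables (P : probability T R) (X : {RV P >-> R}).
Implicit Types a b u l M : R.

Lemma measurable_mgf l :
  measurable_fun setT (EFin \o (fun w => expR (l * X w))).
Proof.
apply/measurable_EFinP.
apply: measurableT_comp; first exact: measurable_expR.
exact: measurable_funM.
Qed.

Lemma measurable_expR_orlicz a u :
  measurable_fun setT (EFin \o (fun w => expR ((`|X w| / u) `^ a))).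
Proof.
apply/measurable_EFinP.
apply: measurableT_comp; first exact: measurable_expR.
apply: (@measurableT_comp _ _ _ _ _ _ (fun x => x `^ a)).
  exact: measurable_powR.
apply: measurable_funM => //.
by apply: measurableT_comp.
Qed.

Definition orlicz_admissible a u :=
  0 < u /\ ('E_P[fun w => expR ((`|X w| / u) `^ a)] <= 2%:E)%E.

Lemma mgf_le_young a b u l :
  1 < a -> 1 < b -> a^-1 + b^-1 = 1 -> orlicz_admissible a u -> 0 <= l ->
  ('E_P[fun w => expR (l * X w)] <= (2 * expR ((l * u) `^ b))%:E)%E.
Proof.
move=> a1 b1 ab [u0]; rewrite unlock => E2 l0.
apply: (@le_trans _ _ (\int[P]_w
   ((expR ((l * u) `^ b))%:E * (expR ((`|X w| / u) `^ a))%:E))%E).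
  apply: ge0_le_integral => //.
  - exact: measurable_mgf.
  - by apply: emeasurable_funM => //; exact: measurable_expR_orlicz.
  - by move=> w _; rewrite -EFinM lee_fin; exact: expR_le_orlicz_young.
rewrite ge0_integralZl_EFin //; last exact: measurable_expR_orlicz.
by rewrite [2 * _]mulrC EFinM lee_wpmul2l // lee_fin expR_ge0.
Qed.

(** Integrates [expR_le_orlicz_quad]. The linear term is allowed to vanish only
    once [X] is known to be integrable, which follows from
    [|X| <= u e^(|X|/u)]. *)
Lemma mgf_le_quad a u l :
  1 <= a -> ('E_P[X] = 0)%E -> orlicz_admissible a u ->
  0 <= l -> l * u <= 1 / 2 ->
  ('E_P[fun w => expR (l * X w)] <= (1 + 32 * expR 1 * (l * u) ^+ 2)%:E)%E.
Proof.
have EE (Y : T -> R) : ('E_P[Y] = \int[P]_w (Y w)%:E)%E by rewrite unlock.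
move=> a1; rewrite /orlicz_admissible !EE => EX0 [u0 E2] l0 lu.
set G := fun w => (expR ((`|X w| / u) `^ a))%:E.
have mG : measurable_fun setT (G : T -> \bar R) by exact: measurable_expR_orlicz.
have G0 w : (0 <= G w)%E by rewrite lee_fin expR_ge0.
have iG : P.-integrable setT G.
  apply/integrableP; split=> //.
  have -> : (\int[P]_w `|G w| = \int[P]_w G w)%E.
    by apply: eq_integral => w _; rewrite gee0_abs.
  by apply: le_lt_trans E2 _; rewrite ltry.
have iX : P.-integrable setT (EFin \o X).
  apply: (le_integrable _ _ _ (integrableZl _ (u * expR 1) iG)) => //.
    exact/measurable_EFinP.
  move=> w _; rewrite /G -EFinM !abse_EFin lee_fin.
  have y0 : 0 <= `|X w| / u by rewrite divr_ge0 // ltW.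
  rewrite [leRHS]ger0_norm; last by rewrite !mulr_ge0 ?expR_ge0 // ltW.
  rewrite /= -[leLHS](@divfK _ u) ?gt_eqF // mulrC -mulrA ler_pM2l //.
  apply: le_trans (expR_le_powR y0 a1).
  by have := expR_ge1Dx (`|X w| / u); lra.
have iC : P.-integrable setT (EFin \o cst 1).
  exact: finite_measure_integrable_cst.
pose c := 16 * expR 1 * (l * u) ^+ 2.
have c0 : 0 <= c by rewrite /c !mulr_ge0 ?expR_ge0 // ltW.
have iXl := integrableZl measurableT l iX.
have iA := integrableD measurableT iC iXl.
have iGc := integrableZl measurableT c iG.
have iS := integrableD measurableT iA iGc.
apply: (@le_trans _ _ (\int[P]_w
   (((EFin \o cst 1%R) w + l%:E * (EFin \o X) w) + c%:E * G w))%E).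
  apply: ge0_le_integral => //.
  - exact: measurable_mgf.
  - exact: measurable_int iS.
  - move=> w _; rewrite /G /= -!EFinM -!EFinD lee_fin.
    exact: expR_le_orlicz_quad.
rewrite integralD // integralD // !integralZl // EX0 mule0 adde0.
have -> : (\int[P]_w (EFin \o cst 1%R) w = 1)%E.
  by have := expectation_cst P 1; rewrite EE.
rewrite EFinD leeD2l //.
apply: (le_trans (lee_wpmul2l _ E2)); rewrite ?lee_fin //.
by rewrite -?EFinM ?lee_fin /c; lra.
Qed.

Lemma orlicz_norm_ge0 a : (0 <= orlicz_norm P a X)%E.
Proof. by apply/ereal_infP => _ [u [u0 _] <-]; rewrite lee_fin ltW. Qed.

Lemma orlicz_admissible_lt a M : (orlicz_norm P a X < M%:E)%E ->
  exists2 u, orlicz_admissible a u & u < M.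
Proof. by move=> /ereal_inf_lt [_ [u hu <-]]; rewrite lte_fin; exists u. Qed.

End moment_generating_function.

(** * Bounds in terms of the Orlicz norm *)

Section orlicz_bounds.
Context (R : realType) (d : measure_display) (T : measurableType d).
Variables (P : probability T R) (X : {RV P >-> R}).
Implicit Types a b l tau : R.

Lemma mgf_le_sub_gaussian a l : 1 <= a -> ('E_P[X] = 0)%E ->
  (orlicz_norm P a X < +oo)%E ->
  let K := l * fine (orlicz_norm P a X) in 0 <= l -> 4 * K <= 1 ->
  ('E_P[fun w => expR (l * X w)] <= (expR (128 * expR 1 * K ^+ 2))%:E)%E.
Proof.
move=> a1 EX0 Noo K l0 K4; rewrite /K in K4 *; move: K4.
have NE : (fine (orlicz_norm P a X))%:E = orlicz_norm P a X.
  by rewrite fineK // ge0_fin_numE // orlicz_norm_ge0.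
have := orlicz_norm_ge0 X a; rewrite -NE lee_fin /=.
set N := fine _ in NE * => N0 K4.
have e0 := expR_gt0 (1 : R).
(* Any [M] above the norm may stand in for an admissible scale. *)
have near M : N < M -> l * M <= 1 / 2 ->
    ('E_P[fun w => expR (l * X w)] <= (1 + 32 * expR 1 * (l * M) ^+ 2)%:E)%E.
  move=> NM lM; have [|u [u0 uadm] uM] := @orlicz_admissible_lt R d T P X a M.
    by rewrite -NE lte_fin.
  have lu : l * u <= l * M by rewrite ler_wpM2l // ltW.
  have lu0 : 0 <= l * u by rewrite mulr_ge0 // ltW.
  apply: le_trans (mgf_le_quad a1 EX0 (conj u0 uadm) l0 _) _; first by lra.
  rewrite lee_fin lerD2l ler_wpM2l ?mulr_ge0 ?expR_ge0 //.
  by rewrite ler_sqr ?nnegrE //; lra.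
have [Npos|N00] := ltP 0 N.
  apply: le_trans (near (2 * N) _ _) _; [lra|lra|rewrite lee_fin].
  apply: le_trans (expR_ge1Dx _); lra.
have {}N00 : N = 0 by lra.
rewrite N00 mulr0 expr0n /= mulr0 expR0.
(* The norm vanishes: take [M = m / D], so small that [l M <= 1/2] and the
   quadratic term is at most [e]. *)
apply/lee_addgt0Pr => e e1.
pose D := 1 + l + 32 * expR 1 * l.
have el0 : 0 <= 32 * expR 1 * l by rewrite mulr_ge0 //; lra.
have D0 : 0 < D by rewrite /D; lra.
pose m := Num.min (1 / 2) e.
have m0 : 0 < m by rewrite /m lt_min e1 andbT; lra.
have m2 : m <= 1 / 2 by rewrite /m ge_min lexx.
have me : m <= e by rewrite /m ge_min lexx orbT.
have lm : l * (m / D) <= m.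
  by rewrite mulrA ler_pdivrMr // mulrC ler_pM2l // /D; lra.
have lm2 : 32 * expR 1 * l * (m / D) <= m.
  by rewrite mulrA ler_pdivrMr // mulrC ler_pM2l // /D; lra.
have lm0 : 0 <= l * (m / D) by rewrite mulr_ge0 // ltW // divr_gt0.
apply: le_trans (near (m / D) _ _) _.
- by rewrite N00 divr_gt0.
- lra.
- rewrite -EFinD lee_fin lerD2l; nra.
Qed.

(** Since [K >= tau/4 > 0], the norm is positive and an admissible scale exists
    below twice the norm; this is the [2 K] in [two_expR_powR_le]. *)
Lemma mgf_le_young_norm a b l tau :
  1 < a -> 1 < b -> a^-1 + b^-1 = 1 ->
  (orlicz_norm P a X < +oo)%E ->
  let K := l * fine (orlicz_norm P a X) in
  0 <= l -> 0 < tau -> tau <= 1 -> tau <= 4 * K ->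
  ('E_P[fun w => expR (l * X w)] <= (expR ((8 * K / tau) `^ b))%:E)%E.
Proof.
move=> a1 b1 ab Noo K l0 t0 t1 tK; rewrite /K in tK *; move: tK.
have NE : (fine (orlicz_norm P a X))%:E = orlicz_norm P a X.
  by rewrite fineK // ge0_fin_numE // orlicz_norm_ge0.
have := orlicz_norm_ge0 X a; rewrite -NE lee_fin /=.
set N := fine _ in NE * => N0 tK.
have Npos : 0 < N.
  by rewrite lt_neqAle N0 andbT; apply/eqP => N00; move: tK; rewrite -N00; lra.
have [|u [u0 uadm] uM] := @orlicz_admissible_lt R d T P X a (2 * N).
  by rewrite -NE lte_fin; lra.
apply: le_trans (mgf_le_young a1 b1 ab (conj u0 uadm) l0) _.
rewrite lee_fin; apply: le_trans (two_expR_powR_le (ltW b1) t0 t1 tK).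
rewrite ler_pM2l // ler_expR; apply: ge0_ler_powR; rewrite ?nnegrE.
- lra.
- by rewrite mulr_ge0 // ltW.
- by rewrite mulr_ge0 // mulr_ge0.
- by rewrite mulrCA ler_wpM2l // ltW.
Qed.

End orlicz_bounds.

(** * Thresholds in the extended reals *)

Section thresholds.
Variable R : realType.
Implicit Types tau l c : R.

(** When [N = 0] the threshold is [+oo] and its hypothesis carries no
    information, but then the left-hand side of the conclusion is [0]. *)
Lemma le_threshold tau l c (N : \bar R) :
  0 < tau -> 0 < c -> (0 <= N < +oo)%E ->
  (l%:E <= tau%:E / (c%:E * N))%E -> c * (l * fine N) <= tau.
Proof.
move=> t0 c0 /andP[]; case: N => [N| |] //; rewrite lee_fin /= => N0 _.
rewrite -EFinM inver mulf_eq0 (gt_eqF c0) /=.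
have [-> _|Nn0] := eqVneq N 0; first by rewrite !mulr0 ltW.
have Npos : 0 < N by rewrite lt_neqAle eq_sym Nn0.
by rewrite -EFinM lee_fin ler_pdivlMr ?mulr_gt0 // mulrCA.
Qed.

(** Here the case [N = 0] is contradictory, no real number being above [+oo]. *)
Lemma ge_threshold tau l c (N : \bar R) :
  0 < tau -> 0 < c -> (0 <= N < +oo)%E ->
  (tau%:E / (c%:E * N) <= l%:E)%E -> tau <= c * (l * fine N).
Proof.
move=> t0 c0 /andP[]; case: N => [N| |] //; rewrite lee_fin /= => N0 _.
rewrite -EFinM inver mulf_eq0 (gt_eqF c0) /=.
have [->|Nn0] := eqVneq N 0; first by rewrite gt0_muley ?lte_fin // leye_eq.
have Npos : 0 < N by rewrite lt_neqAle eq_sym Nn0.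
by rewrite -EFinM lee_fin ler_pdivrMr ?mulr_gt0 // mulrCA.
Qed.

End thresholds.

(** * The bounds on the moment generating function *)

(* Thresholds such as tau / (C * norm) are taken in [\bar R], where 0^-1 = +oo,
   so they are meaningful also when the norm vanishes. *)
Theorem lemma1 (R : realType) :
  exists C C1 C2 C3 C4 C5 : R,
    [/\ 0 < C, 0 < C1 & 0 < C2] /\ [/\ 0 < C3, 0 < C4 & 0 < C5] /\
    forall (alpha beta : R),
      1 < alpha -> alpha^-1 + beta^-1 = 1 ->
    forall (d : measure_display) (T : measurableType d)
      (P : probability T R) (X : {RV P >-> R}),
      ('E_P[X] = 0)%E -> (orlicz_norm P alpha X < +oo)%E ->
    let N := fine (orlicz_norm P alpha X) in
    forall lambda : R, 0 <= lambda ->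
      (2 <= alpha ->
        ('E_P[fun w => expR (lambda * X w)] <=
          (expR (C1 * Num.min (lambda ^+ 2 * N ^+ 2)
                              (lambda `^ beta * N `^ beta)))%:E)%E)
      /\
      (alpha <= 2 ->
        ((lambda%:E <= 1%:E / (C%:E * orlicz_norm P alpha X))%E ->
          ('E_P[fun w => expR (lambda * X w)] <=
            (expR (C2 * beta * lambda ^+ 2 * N ^+ 2))%:E)%E)
        /\
        ((1%:E / (C%:E * orlicz_norm P alpha X) <= lambda%:E)%E ->
          ('E_P[fun w => expR (lambda * X w)] <=
            (expR (C3 `^ beta * beta * lambda `^ beta * N `^ beta))%:E)%E)
        /\
        (forall tau : R, 0 < tau -> tau < 1 ->
          ((lambda%:E <= tau%:E / (C%:E * orlicz_norm P alpha X))%E ->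
            ('E_P[fun w => expR (lambda * X w)] <=
              (expR (C4 * (1 / (1 - tau)) * lambda ^+ 2 * N ^+ 2))%:E)%E)
          /\
          ((tau%:E / (C%:E * orlicz_norm P alpha X) <= lambda%:E)%E ->
            ('E_P[fun w => expR (lambda * X w)] <=
              (expR (C5 `^ beta * (tau ^ (- Num.floor beta - 1) / (1 - tau))
                     * lambda `^ beta * N `^ beta))%:E)%E))).
Proof.
(* [32 e (lambda u)^2] with [u = 2 N]; at least [64 = 8^2], the constant needed
   beyond the threshold when [beta <= 2]. *)
pose G := 128 * expR 1 : R.
have e1 : 2 <= expR (1 : R) by have := expR_ge1Dx (1 : R); lra.
have G64 : 64 <= G by rewrite /G; lra.
exists 4, G, G, 8, G, 8; split; [split; lra|split; [split; lra|]].
move=> alpha beta a1 ab d T P X EX0 Noo N lambda l0.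
have a0 : 0 < alpha by lra.
have ai1 : alpha^-1 < 1 by rewrite invf_lt1.
have ai0 : 0 < alpha^-1 by rewrite invr_gt0.
have b0 : 0 < beta by rewrite -invr_gt0; lra.
have b1 : 1 < beta by rewrite -invf_lt1 //; lra.
have N0 : 0 <= N by rewrite fine_ge0 // orlicz_norm_ge0.
have Nfin : (0 <= orlicz_norm P alpha X < +oo)%E by rewrite orlicz_norm_ge0.
have K0 : 0 <= lambda * N by rewrite mulr_ge0.
have small : 4 * (lambda * N) <= 1 -> ('E_P[fun w => expR (lambda * X w)] <=
    (expR (G * (lambda * N) ^+ 2))%:E)%E.
  by move=> K4; apply: mgf_le_sub_gaussian (ltW a1) EX0 Noo l0 K4.
have large tau : 0 < tau -> tau <= 1 -> tau <= 4 * (lambda * N) ->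
    ('E_P[fun w => expR (lambda * X w)] <=
     (expR ((8 * (lambda * N) / tau) `^ beta))%:E)%E.
  by move=> t0 t1 tK; apply: mgf_le_young_norm a1 b1 ab Noo l0 t0 t1 tK.
split=> [a2|a2].
  have b2 : beta <= 2.
    suff : 2^-1 <= beta^-1 by rewrite lef_pV2 // posrE.
    have : alpha^-1 <= 2^-1 by rewrite lef_pV2 // posrE.
    lra.
  rewrite -exprMn -powRM //; set K := lambda * N in K0 small large *.
  have [K4|K4] := leP (4 * K) 1.
    apply: le_trans (small K4) _; rewrite lee_fin ler_expR.
    apply: ler_wpM2l; first by lra.
    rewrite le_min lexx /=.
    have [->|Kn0] := eqVneq K 0; first by rewrite expr0n powR0 // gt_eqF.
    have Kpos : 0 < K by rewrite lt_neqAle eq_sym Kn0.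
    by rewrite -powR_mulrn // ger_powR // Kpos; lra.
  apply: le_trans (large 1 _ _ _) _; [lra|lra|exact: ltW|].
  rewrite lee_fin ler_expR divr1.
  have hq : (8 * K) `^ beta <= 64 * K ^+ 2.
    apply: le_trans (_ : (8 * K) `^ 2%:R <= _); first by rewrite ler_powR //; lra.
    by rewrite powR_mulrn; [rewrite exprMn; lra|lra].
  have hp : (8 * K) `^ beta <= 64 * K `^ beta.
    rewrite powRM // ler_wpM2r ?powR_ge0 //.
    apply: le_trans (_ : 8 `^ 2%:R <= _); first by rewrite ler_powR //; lra.
    by rewrite powR_mulrn //; lra.
  apply: le_trans (_ : 64 * Num.min (K ^+ 2) (K `^ beta) <= _).
    by rewrite minEle; case: ifP.
  by rewrite ler_wpM2r // le_min sqr_ge0 powR_ge0.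
have quad c : 1 <= c -> 4 * (lambda * N) <= 1 ->
    ('E_P[fun w => expR (lambda * X w)] <=
     (expR (G * c * lambda ^+ 2 * N ^+ 2))%:E)%E.
  move=> c1 K4; apply: le_trans (small K4) _; rewrite lee_fin ler_expR.
  rewrite [leRHS](_ : _ = c * (G * (lambda * N) ^+ 2)); last by ring.
  by rewrite ler_peMl // mulr_ge0 ?sqr_ge0 //; lra.
have gt04 : (0 : R) < 4 by [].
split; last split.
- by move=> /(le_threshold ltr01 gt04 Nfin); apply: quad; exact: ltW.
- move=> /(ge_threshold ltr01 gt04 Nfin) K4.
  apply: le_trans (large 1 ltr01 _ K4) _; first by [].
  rewrite lee_fin ler_expR divr1 powRM // powRM //.
  rewrite [leRHS](_ : _ = beta * (8 `^ beta * (lambda `^ beta * N `^ beta)));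
    last by ring.
  by rewrite ler_peMl ?mulr_ge0 ?powR_ge0 // ltW.
- move=> tau t0 t1; split=> [/(le_threshold t0 gt04 Nfin) K4|].
    apply: quad; last by apply: (le_trans K4); lra.
    by rewrite ler_pdivlMr ?subr_gt0 //; lra.
  move=> /(ge_threshold t0 gt04 Nfin) K4.
  apply: le_trans (large tau t0 (ltW t1) K4) _; rewrite lee_fin ler_expR.
  apply: le_trans (powR_div_floor_le beta t0 t1 _) _; first by rewrite mulr_ge0.
  rewrite powRM // powRM // le_eqVlt; apply/orP; left; apply/eqP; ring.
Qed.
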